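(* Let $d$ and $R$ be positive integers. Then there exist only finitely many totally real number fields $K$ of degree $d$ such that the codifferent $\mathcal{O}_K^\vee$ is generated by a totally positive element and such that there is a universal quadratic form of rank $R$ over $\mathcal{O}_K$.
   Context: For a totally real number field $K$ with ring of integers $\mathcal{O}_K$, the codifferent is $\mathcal{O}_K^{\vee}=\{\alpha\in K : \mathrm{Tr}_{K/\mathbb{Q}}(\alpha\mathcal{O}_K)\subseteq\mathbb{Z}\}$, a fractional ideal. An element of $K$ is totally positive if all its images under the real embeddings of $K$ are positive; $\mathcal{O}_K^+$ is the set of totally positive elements of $\mathcal{O}_K$. A quadratic form $Q$ of rank $R$ over $\mathcal{O}_K$ is a quadratic form in $R$ variables with coefficients in $\mathcal{O}_K$ (not necessarily classical). It is universal if it is totally positive definite (i.e. $Q(x)$ is totally positive for all nonzero $x\in\mathcal{O}_K^R$) and for every $w\in\mathcal{O}_K^+$ there is $x\in\mathcal{O}_K^R$ with $Q(x)=w$. Number fields are counted as subfields of a fixed algebraic closure of $\mathbb{Q}$ (equivalently, for the purpose of finiteness, up to isomorphism). *)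

(* Defs.v *)
From HB Require Import structures.
From mathcomp Require Import all_boot all_order all_algebra all_field.
From mathcomp Require Import all_classical.

Set Implicit Arguments.
Unset Strict Implicit.
Unset Printing Implicit Defensive.

Import Order.TTheory GRing.Theory Num.Theory.

Local Open Scope classical_set_scope.
Local Open Scope ring_scope.

(* A number field is a [fieldExtType rat]; its degree is [\dim {:K}].  Ring
   morphisms K -> algC are the embeddings of K into the complex numbers, since
   their images consist of algebraic numbers. *)

Definition real_embedding (K : fieldExtType rat) (f : {rmorphism K -> algC}) :=
  forall x : K, f x \is Num.real.

Definition totally_real (K : fieldExtType rat) :=
  forall f : {rmorphism K -> algC}, real_embedding f.

Definition totally_positive (K : fieldExtType rat) (x : K) :=
  forall f : {rmorphism K -> algC}, real_embedding f -> 0 < f x.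

Definition ring_of_integers (K : fieldExtType rat) : set K :=
  [set x | integralOver (intr : int -> K) x].
Arguments ring_of_integers K : clear implicits.

Definition field_trace (K : fieldExtType rat) (x : K) : rat :=
  \tr (passmx.mxof (vbasis {:K}) (vbasis {:K}) (amull x)).

Definition codifferent (K : fieldExtType rat) : set K :=
  [set a | forall x : K, ring_of_integers K x ->
             field_trace (a * x) \is a Num.int].
Arguments codifferent K : clear implicits.

Definition codifferent_generated_by (K : fieldExtType rat) (g : K) :=
  codifferent K = [set g * x | x in ring_of_integers K].

(* The form \sum_(i <= j) a_ij x_i x_j; the entries of [a] below the diagonal
   play no role.  Off-diagonal coefficients a_ij need not be divisible by 2. *)
Definition qform (K : fieldExtType rat) (R : nat) (a : 'M[K]_R)
    (x : 'rV[K]_R) : K :=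
  \sum_(i < R) \sum_(j < R | (i <= j)%N) a i j * x 0 i * x 0 j.

Definition integral_mx (K : fieldExtType rat) (m n : nat) (a : 'M[K]_(m, n)) :=
  forall i j, ring_of_integers K (a i j).

Definition universal_qform (K : fieldExtType rat) (R : nat) (a : 'M[K]_R) :=
  [/\ integral_mx a,
      forall x : 'rV[K]_R, integral_mx x -> x != 0 ->
        totally_positive (qform a x)
    & forall w : K, ring_of_integers K w -> totally_positive w ->
        exists2 x : 'rV[K]_R, integral_mx x & qform a x = w].

(* Main.v *)
(* If the totally positive [g] generates the codifferent, then [Tr (g x y)] is a
   unimodular form on [O_K], so [O_K] contains [d] independent elements [b_k]
   with [Tr (g b_k^2)] bounded in terms of [d] only, and [c], the sum of the
   [b_k^2], is such that [g c] is bounded below at every embedding.  If [Q] is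
   universal, [Tr (g Q)] is an integral positive definite form of rank [d R];
   such a form has boundedly many vectors of bounded length, so there are
   boundedly many totally positive integers [w] with [Tr (g w)] bounded.
   Applied to the elements [c + i x], this bounds [g x] away from [0] for all
   nonzero [x] in [O_K]: the codifferent has no short vector.  By transference,
   its dual [O_K], now with the form [Tr (x y)], contains [d] independent
   elements with bounded conjugates, and these leave finitely many fields. *)
Require Import Defs.
From HB Require Import structures.
From mathcomp Require Import all_boot all_order all_algebra all_field.
From mathcomp Require Import all_classical.
From mathcomp Require Import perm ring lra zify.

Set Implicit Arguments.
Unset Strict Implicit.
Unset Printing Implicit Defensive.

Import Order.TTheory GRing.Theory Num.Theory.

Local Open Scope classical_set_scope.
Local Open Scope ring_scope.

(** * Embeddings, trace and characteristic polynomial *)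

Section Embeddings.
Variable K : fieldExtType rat.

Let pK (p : {poly rat}) : {poly K} := map_poly (in_alg K) p.
Let pC (p : {poly rat}) : {poly algC} := map_poly ratr p.

Lemma embedding_horner (f : {rmorphism K -> algC}) (p : {poly rat}) (x : K) :
  f (pK p).[x] = (pC p).[f x].
Proof.
rewrite -horner_map /= -map_poly_comp; congr (_.[_]).
by apply: eq_map_poly => a /=; rewrite rmorphZ_num rmorph1 mulr1.
Qed.

(** Send [p(th)] to [p(z)]: two polynomials with the same value at [th] differ by a multiple of [m],
    which vanishes at [z]. *)
Lemma root_embedding (th : K) (m : {poly rat}) (z : algC) :
    (forall x : K, exists p, (pK p).[th] = x) ->
    (forall p, root (pK p) th -> m %| p) -> root (pC m) z ->
  exists f : {rmorphism K -> algC}, f th = z.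
Proof.
move=> /choice[P PE] mP mz.
have eqP' p q : (pK p).[th] = (pK q).[th] -> (pC p).[z] = (pC q).[z].
  move=> epq; apply/eqP; rewrite -subr_eq0 -hornerN -hornerD -rmorphB.
  have : m %| p - q.
    by apply: mP; rewrite /root /pK rmorphB hornerD hornerN subr_eq0; apply/eqP.
  by case/dvdpP => r ->; rewrite /pC rmorphM hornerM (eqP mz) mulr0.
pose f x := (pC (P x)).[z].
have fB : zmod_morphism f.
  move=> x y; rewrite /f -hornerN -hornerD -rmorphB; apply: eqP'.
  by rewrite PE /pK rmorphB hornerD hornerN !PE.
have fM : monoid_morphism f.
  split; last first.
    move=> x y; rewrite /f -hornerM.
    have <- : pC (P x * P y) = pC (P x) * pC (P y) by rewrite /pC rmorphM.
    by apply: eqP'; rewrite PE /pK rmorphM hornerM !PE.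
  rewrite /f; have -> : 1 = (pC 1).[z] by rewrite /pC rmorph1 hornerC.
  by apply: eqP'; rewrite PE /pK rmorph1 hornerC.
pose F : {rmorphism K -> algC} := HB.pack f
  (GRing.isZmodMorphism.Build K algC f fB)
  (GRing.isMonoidMorphism.Build K algC f fM).
exists F; rewrite /= /f; transitivity (pC 'X).[z].
  by apply: eqP'; rewrite PE /pK map_polyX hornerX.
by rewrite /pC map_polyX hornerX.
Qed.

(** Characteristic 0 provides a primitive element [th]. Its minimal polynomial has degree
    [\dim {:K}] and distinct roots in [algC]; each root gives an embedding, and an embedding is
    determined by the root to which it sends [th]. *)
Lemma embedding_enum :
  exists (f : 'I_(\dim {:K}) -> {rmorphism K -> algC}) (th : K),
    [/\ injective (fun i => f i th),
        forall x : K, exists p, (pK p).[th] = x &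
        forall g : {rmorphism K -> algC}, exists i, forall x, g x = f i x].
Proof.
have char0K : has_char0 K.
  apply/pcharf0P => n; rewrite -(rmorph_nat (in_alg K)) fmorph_eq0.
  by rewrite pnatr_eq0.
have sep1 : separable (1%AS : {subfield K}) (fullv : {subfield K}).
  by apply/allP => x _; apply: pcharf0_separable.
pose th := separable_generator (1%AS : {subfield K}) (fullv : {subfield K}).
have Kth : fullv = <<1%AS; th>>%VS :> {vspace K}.
  exact: eq_adjoin_separable_generator sep1 (subvf _).
have [m mE] : exists m, minPoly 1%AS th = pK m.
  by apply/polyOver1P; apply: minPolyOver.
have thP x : exists p, (pK p).[th] = x.
  have /polyOver1P[p pE] : Fadjoin_poly 1%AS th x \is a polyOver 1%VS.
    exact: Fadjoin_polyOver.
  by exists p; move: pE; rewrite -/(pK p) => <-; rewrite Fadjoin_poly_eq // -Kth memvf.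
have mP p : root (pK p) th -> m %| p.
  move=> pth; rewrite -(dvdp_map (in_alg K)) -/(pK _) -/(pK _) -mE.
  by apply: minPoly_dvdp => //; apply: alg_polyOver.
have smd : size m = (\dim {:K}).+1.
  have <- : size (pK m) = size m by rewrite size_map_poly.
  by rewrite -mE size_minPoly Kth dim_Fadjoin dimv1 muln1.
have m0 : m != 0 by rewrite -size_poly_eq0 smd.
have sepm : separable_poly m.
  rewrite -(separable_map (in_alg K)) -/(pK m) -mE.
  by have := pcharf0_separable 1%AS char0K th.
have [r rE] := closed_field_poly_normal (pC m).
have pCm0 : lead_coef (pC m) != 0 by rewrite lead_coef_eq0 map_poly_eq0.
have ur : uniq r.
  have : separable_poly (pC m).
    by rewrite /pC (separable_map (ratr : {rmorphism rat -> algC})).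
  by rewrite rE (eqp_separable (eqp_scale _ pCm0)) separable_prod_XsubC.
have sr : size r = \dim {:K}.
  apply: succn_inj; rewrite -smd -(size_map_poly (ratr : {rmorphism rat -> algC})).
  by rewrite -/(pC m) rE size_scale // size_prod_XsubC.
have rootr z : root (pC m) z = (z \in r) by rewrite rE rootZ // root_prod_XsubC.
have /choice[f fE] : forall i : 'I_(\dim {:K}),
    exists g : {rmorphism K -> algC}, g th = r`_i.
  move=> i.
  apply: (root_embedding (m := m)) => //.
  by rewrite rootr mem_nth // sr.
exists f, th; split=> //.
- move=> i j; rewrite !fE => /eqP; rewrite nth_uniq ?sr // => /eqP.
  exact: val_inj.
move=> g; have : g th \in r.
  rewrite -rootr /root -embedding_horner -mE minPolyxx rmorph0 eqxx //.
rewrite -index_mem sr => ir; exists (Ordinal ir) => x.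
have [p <-] := thP x; rewrite !embedding_horner fE /= nth_index //.
by rewrite -index_mem sr.
Qed.

End Embeddings.

Lemma char_poly_similar (F : fieldType) n (A E D : 'M[F]_n) :
  E \in unitmx -> A *m E = E *m D -> char_poly A = char_poly D.
Proof.
move=> Eu AE; pose E' := map_mx polyC E.
have dE : \det E' != 0 by rewrite det_map_mx polyC_eq0 -unitfE -unitmxE.
apply: (mulIf dE); rewrite [RHS]mulrC -!det_mulmx; congr (\det _).
rewrite mulmxBl mulmxBr -!map_mxM AE; congr (_ - _).
by rewrite mul_scalar_mx mul_mx_scalar.
Qed.

(** The matrix [E] of conjugates of a basis diagonalizes multiplication by every [x] at once, with
    eigenvalues [f i x]; trace and characteristic polynomial are read off from these. *)
Lemma embedding_spectrum (K : fieldExtType rat) :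
  exists f : 'I_(\dim {:K}) -> {rmorphism K -> algC},
    [/\ forall g : {rmorphism K -> algC}, exists i, forall x, g x = f i x,
        forall x, ratr (field_trace x) = \sum_i f i x &
        forall x, exists p : {poly rat},
          map_poly ratr p = \prod_i ('X - (f i x)%:P)].
Proof.
have [f [th [f_inj _ f_all]]] := embedding_enum K.
exists f; set n := \dim {:K} in f f_inj f_all *.
pose e := vbasis {:K}; pose M x := passmx.mxof e e (amull x).
have be : basis_of {:K} e := vbasisP _.
pose E : 'M[algC]_n := \matrix_(j, l) f l e`_j.
pose D x : 'M[algC]_n := diag_mx (\row_l f l x).
have coordE l (y : K) : f l y = \sum_j ratr (coord e j y) * E j l.
  rewrite {1}(coord_basis be (memvf y)) rmorph_sum; apply: eq_bigr => j _.
  by rewrite rmorphZ_num mxE.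
have Eu : E \in unitmx.
  (* [P] expresses the powers of [th] in the basis, so [P *m E] is the Vandermonde matrix of the
     distinct conjugates of [th]. *)
  pose P : 'M[algC]_n := \matrix_(j, k) ratr (coord e k (th ^+ j)).
  have PE : P *m E = Vandermonde n (\row_l f l th).
    apply/matrixP => j l; rewrite !mxE -rmorphXn coordE.
    by apply: eq_bigr => k _; rewrite !mxE.
  rewrite unitmxE unitfE; apply/negP => /eqP dE.
  have /eqP := congr1 determinant PE; rewrite det_mulmx dE mulr0 det_Vandermonde.
  rewrite eq_sym prodf_seq_eq0 => /hasP[i _ /=].
  rewrite prodf_seq_eq0 => /hasP[j _ /= /andP[ij]].
  by rewrite !mxE subr_eq0 => /eqP/f_inj eij; rewrite eij ltnn in ij.
have ME x : map_mx ratr (M x) *m E = E *m D x.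
  apply/matrixP => i l; rewrite mul_mx_diag !mxE -rmorphM coordE.
  apply: eq_bigr => j _; rewrite !mxE; congr (ratr _ * _).
  by rewrite /= passmx.vecof_delta lfunE /= mulrC.
split=> // x.
- rewrite /field_trace -/e -/(M x) -trace_map_mx -[map_mx _ _](mulmxK Eu) ME.
  by rewrite mxtrace_mulC mulKmx // mxtrace_diag; apply: eq_bigr => i _; rewrite mxE.
- exists (char_poly (M x)).
  rewrite map_char_poly (char_poly_similar Eu (ME x)) char_poly_trig.
    by apply: eq_bigr => i _; rewrite !mxE eqxx mulr1n.
  exact: diag_mx_is_trig.
Qed.

(** * Transference: short bases from the absence of short dual vectors *)

Section Transference.
Variables (vT : vectType rat) (T : vT -> vT -> rat).
Hypotheses (TC : forall x y, T x y = T y x)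
  (TDl : forall x y z, T (x + y) z = T x z + T y z)
  (TZl : forall a x z, T (a *: x) z = a * T x z)
  (T_gt0 : forall x, x != 0 -> 0 < T x x).

Let TZr a x z : T z (a *: x) = a * T z x. Proof. by rewrite TC TZl TC. Qed.
Let TDr x y z : T z (x + y) = T z x + T z y. Proof. by rewrite TC TDl !(TC z). Qed.
Let TBr x y z : T z (x - y) = T z x - T z y.
Proof. by rewrite TDr -scaleN1r TZr mulN1r. Qed.
Let TBl x y z : T (x - y) z = T x z - T y z.
Proof. by rewrite !(TC _ z) TBr. Qed.
Let T0l x : T 0 x = 0. Proof. by rewrite -(scale0r 0) TZl mul0r. Qed.
Let T_ge0 x : 0 <= T x x.
Proof. by have [->|/T_gt0/ltW//] := eqVneq x 0; rewrite T0l. Qed.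

(** [D] is a common denominator: [D * T x x] is a natural number for [x] in [L], so a least nonzero
    value exists. *)
Lemma exists_shortest (L : vT -> Prop) (D : rat) :
    0 < D -> (forall x y, L x -> L y -> D * T x y \is a Num.int) ->
    (exists2 x, L x & x != 0) ->
  exists v, [/\ L v, v != 0 & forall x, L x -> x != 0 -> T v v <= T x x].
Proof.
move=> D0 LD [x0 Lx0 x0n].
pose P n := `[< exists x, [/\ L x, x != 0 & D * T x x = n%:R] >].
have TP x : L x -> x != 0 -> exists2 n, P n & D * T x x = n%:R.
  move=> Lx xn; have : D * T x x \is a Num.nat.
    by rewrite natrEint LD // mulr_ge0 // ltW.
  by move=> /natrP[n nE]; exists n => //; apply/asboolP; exists x.
have exP : exists n, P n by have [n Pn _] := TP _ Lx0 x0n; exists n.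
case: (ex_minnP exP) => m /asboolP[v [Lv vn vm]] minm.
exists v; split=> // x Lx xn; have [n Pn xE] := TP x Lx xn.
by rewrite -(ler_pM2l D0) vm xE ler_nat minm.
Qed.

(* Induction on [n]: remove a shortest vector [v] of [L] and project [L]
   orthogonally to [v]; the dual of the projection is the part of the dual of
   [L] orthogonal to [v].  Lifting a short basis of the projection back to [L]
   costs [T v v / 4], which is again controlled because [v] is shortest. *)
Lemma transference n (L : vT -> Prop) (V : {vspace vT}) (D eps : rat) :
    \dim V = n -> L 0 -> (forall x y, L x -> L y -> L (x - y)) ->
    (forall x, L x -> x \in V) ->
    0 < D -> (forall x y, L x -> L y -> D * T x y \is a Num.int) ->
    0 < eps ->
    (forall y, y \in V -> y != 0 -> (forall x, L x -> T y x \is a Num.int) ->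
       eps <= T y y) ->
  exists b : seq vT, [/\ size b = n, free b &
    forall x, x \in b -> L x /\ T x x <= (4 / 3) ^+ n / eps].
Proof.
elim: n L V D => [|n IHn] L V D dimV L0 LB LV D0 LD eps0 dual.
  by exists [::]; rewrite nil_free.
(* If [L] were zero, all of [V] would be dual to it, including vectors that are too short: [a <= 1]
   and [a * T w w < eps] give [a ^+ 2 * T w w < eps]. *)
have Lex : exists2 x, L x & x != 0.
  apply: contrapT => nL.
  have Lz x : L x -> x = 0.
    by move=> Lx; apply/eqP; apply: contrapT => /negP xn; apply: nL; exists x.
  have [w wV w0] : exists2 w, w \in V & w != 0.
    exists (vpick V); rewrite ?memv_pick // vpick0 -dimv_eq0 dimV //.
  have Tw := T_gt0 w0.
  pose a := eps / (eps + T w w).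
  have a0 : 0 < a by rewrite divr_gt0 // addr_gt0.
  have : eps <= T (a *: w) (a *: w).
    apply: dual; rewrite ?memvZ // ?scaler_eq0 ?negb_or ?w0 ?gt_eqF //.
    by move=> x /Lz ->; rewrite TC T0l.
  rewrite TZl TZr leNgt => /negP; apply.
  have aT : a * T w w < eps by rewrite /a mulrAC ltr_pdivrMr ?addr_gt0 //; nra.
  have a1 : a <= 1 by rewrite /a ler_pdivrMr ?addr_gt0 //; lra.
  by apply: le_lt_trans aT; rewrite ler_piMl // mulr_ge0 // ltW.
have [v [Lv vn vmin]] := exists_shortest D0 LD Lex.
have Tv := T_gt0 vn.
pose c x := T x v / T v v.
pose p x := x - c x *: v.
have cvv : c v = 1 by rewrite /c divff // gt_eqF.
have p_lin : linear p.
  move=> a x y; rewrite /p /c TDl TZl mulrDl scalerDl scalerBr scalerA mulrA.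
  by rewrite opprD addrACA.
pose pL : {linear vT -> vT} :=
  HB.pack p (GRing.isLinear.Build rat vT vT *:%R p p_lin).
have t_lin : linear (fun x => T x v : rat^o) by move=> a x y; rewrite TDl TZl.
pose tL : {linear vT -> rat^o} :=
  HB.pack (fun x => T x v : rat^o) (GRing.isLinear.Build rat vT rat^o *:%R _ t_lin).
have tE x : linfun tL x = T x v by rewrite lfunE.
have pE x : linfun pL x = p x by rewrite lfunE.
have pv : p v = 0 by rewrite /p cvv scale1r subrr.
have Tpv x : T (p x) v = 0 by rewrite /p TBl TZl /c divfK ?subrr // gt_eqF.
have Tpp x y : T (p x) (p y) = T x y - T x v * T y v / T v v.
  by rewrite {2}/p TBr TZr Tpv mulr0 subr0 {1}/p TBl TZl /c (TC v y) mulrAC.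
have Txx x : T x x = T (p x) (p x) + c x ^+ 2 * T v v.
  by rewrite Tpp /c; field; rewrite gt_eqF.
have LZ (k : int) x : L x -> L (k%:~R *: x).
  move=> Lx; have LN y : L y -> L (- y) by move=> Ly; rewrite -[- y]add0r; apply: LB.
  have Ln m : L (m%:R *: x).
    elim: m => [|m IHm]; first by rewrite scale0r.
    rewrite -addn1 natrD scalerDl scale1r -[x in _ + x]opprK; apply: LB => //.
    exact: LN.
  by case: k => m; [apply: Ln | rewrite NegzE rmorphN scaleNr; apply/LN/Ln].
(* Subtracting the nearest integer multiple of [v] keeps the projection and brings the coefficient
   along [v] between -1/2 and 1/2. *)
have round x : L x ->
  exists y, [/\ L y, p y = p x, c y ^+ 2 <= 4^-1 & c x - c y \is a Num.int].
  move=> Lx; pose k := Num.floor (c x + 2^-1).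
  have Ly : L (x - k%:~R *: v) by apply: LB => //; apply: LZ.
  exists (x - k%:~R *: v).
  have py : p (x - k%:~R *: v) = p x.
    by rewrite -!pE linearB linearZ /= !pE pv scaler0 subr0.
  have -> : c (x - k%:~R *: v) = c x - k%:~R.
    by rewrite /c TBl TZl mulrBl mulfK // gt_eqF.
  split=> //; last by rewrite opprB addrC subrK intr_int.
  have := floor_itv (c x + 2^-1); rewrite -/k intrD => /andP[k1 k2].
  have : `|c x - k%:~R| <= 2^-1 by rewrite ler_norml; lra.
  rewrite -real_normK ?num_real // => h.
  have -> : 4^-1 = 2^-1 ^+ 2 :> rat by [].
  by rewrite lerXn2r // nnegrE.
pose V' := (V :&: lker (linfun tL))%VS.
have dimV' : \dim V' = n.
  have := limg_ker_dim (linfun tL) V.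
  suff -> : \dim (linfun tL @: V) = 1%N by rewrite dimV addn1 => -[].
  apply/eqP; rewrite eqn_leq; apply/andP; split.
    by rewrite (leq_trans (dimvS (subvf _))) // dimvf.
  rewrite lt0n dimv_eq0; apply/negP => /eqP im0.
  have : linfun tL v \in (linfun tL @: V)%VS by rewrite memv_img // LV.
  by rewrite im0 memv0 tE gt_eqF.
have memV' y : (y \in V') = (y \in V) && (T y v == 0).
  by rewrite memv_cap memv_ker tE.
pose L' z := exists2 x, L x & z = p x.
(* The projected form has [T v v] in its denominators, so [D * (D * T v v)] is a common denominator
   for it. *)
have Dv0 : 0 < D * T v v by rewrite mulr_gt0.
have [| | | | | |b' [sb' fb' b'P]] :=
  IHn L' V' (D * (D * T v v)) dimV' _ _ _ _ _ eps0 _.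
- by exists 0 => //; rewrite /p /c T0l mul0r scale0r subr0.
- move=> _ _ [x Lx ->] [y Ly ->]; exists (x - y); first exact: LB.
  by rewrite -!pE linearB.
- move=> _ [x Lx ->]; rewrite memV' Tpv eqxx andbT /p memvB ?memvZ ?LV //.
- by rewrite mulr_gt0.
- move=> _ _ [x Lx ->] [y Ly ->]; rewrite Tpp.
  have -> : D * (D * T v v) * (T x y - T x v * T y v / T v v) =
      (D * T v v) * (D * T x y) - (D * T x v) * (D * T y v).
    by field; rewrite gt_eqF.
  by rewrite rpredB // rpredM // LD.
(* As [y] is orthogonal to [v], it pairs with [p x] as it does with [x], so it is dual to [L]
   itself. *)
- move=> y; rewrite memV' => /andP[yV /eqP yv] yn y'; apply: dual => // x Lx.
  have := y' (p x) (ex_intro2 _ _ x Lx erefl).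
  by rewrite /p TBr TZr yv mulr0 subr0.
set C := (4 / 3) ^+ n / eps in b'P.
have /choice[l lP] : forall z, exists x, z \in b' ->
    [/\ L x, p x = z & T x x <= C + T v v / 4].
  move=> z; have [zb|zb] := boolP (z \in b'); last by exists 0.
  have [[x Lx zE] zC] := b'P z zb; have [y [Ly py cy cxy]] := round x Lx.
  exists y => _; split; rewrite ?py ?zE //.
  by rewrite Txx py -zE lerD // mulrC ler_wpM2l // ltW.
(* If the projection has a basis vector, its lift is at least as long as [v], so
   [T v v <= C + T v v / 4]. Otherwise [L] consists of integer multiples of [v]; then [v / T v v] is
   a dual vector, and [T v v <= 1 / eps]. *)
have TvC : T v v <= 4 / 3 * C.
  case: b' sb' fb' b'P lP => [|z b'] sb' fb' b'P lP; last first.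
    have [Lx px xC] := lP z (mem_head _ _).
    have : T v v <= T (l z) (l z).
      apply: vmin => //; apply: contraTneq (mem_head z b') => x0.
      have z0 : z = 0 by rewrite -px x0 -pE linear0.
      by move: fb'; rewrite free_cons z0 mem0v.
    lra.
  have V'0 : V' = 0%VS by apply/eqP; rewrite -dimv_eq0 dimV' -sb'.
  have c_int x : L x -> c x \is a Num.int.
    move=> Lx; have [y [Ly py cy cxy]] := round x Lx.
    have px0 z : L z -> p z = 0.
      move=> Lz; apply/eqP; rewrite -memv0 -V'0 memV' Tpv eqxx andbT.
      by rewrite /p memvB ?memvZ ?LV.
    have y0 : y = 0.
      apply: contrapT => /eqP yn; have := vmin y Ly yn.
      rewrite (Txx y) px0 // T0l add0r leNgt => /negP; apply.
      by rewrite gtr_pMl //; lra.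
    by move: cxy; rewrite y0 /c T0l mul0r subr0.
  have : eps <= T ((T v v)^-1 *: v) ((T v v)^-1 *: v).
    apply: dual; rewrite ?memvZ ?LV // ?scaler_eq0 ?negb_or ?invr_eq0 ?vn ?gt_eqF //.
    by move=> x Lx; rewrite TZl TC mulrC c_int.
  rewrite TZl TZr mulVf ?(gt_eqF Tv) // mulr1 => h.
  rewrite /C -sb' expr0 div1r (@le_trans _ _ eps^-1) //.
    by rewrite -[T v v]invrK lef_pV2 // posrE invr_gt0.
  by rewrite ler_peMl // invr_ge0 ltW.
have pb : map (linfun pL) (map l b') = b'.
  rewrite -map_comp -[RHS]map_id; apply/eq_in_map => z zb /=.
  by rewrite pE; have [] := lP z zb.
exists (v :: map l b'); split.
- by rewrite /= size_map sb'.
(* The projection maps the lifts onto the free family [b'], so it is injective on their span; [v]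
   lies in its kernel, hence outside that span. *)
- have := limg_ker_dim (linfun pL) <<map l b'>>%VS.
  have /eqP db' := fb'.
  rewrite limg_span pb db' => dimE.
  have dl := dim_span (map l b'); rewrite size_map in dl.
  have dim0 : \dim (<<map l b'>> :&: lker (linfun pL)) = 0%N.
    by apply/eqP; rewrite -leqn0 -(leq_add2r (size b')) dimE.
  have /eqP := dim0; rewrite dimv_eq0 => /eqP ker0.
  rewrite free_cons; apply/andP; split.
    apply/negP => vl.
    have : v \in (<<map l b'>> :&: lker (linfun pL))%VS.
      by rewrite memv_cap vl memv_ker pE pv eqxx.
    by rewrite ker0 memv0 (negPf vn).
  by rewrite /free eqn_leq dim_span size_map -dimE dim0 add0n leqnn.
- move=> x; rewrite inE => /orP[/eqP ->|/mapP[z zb ->]].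
    by split=> //; rewrite exprS -mulrA.
  have [Lx _ xC] := lP z zb; split=> //; rewrite exprS -mulrA -/C; lra.
Qed.
End Transference.

(** * Integers and codifferent of a totally real field *)

Section NumberField.
Variable K : fieldExtType rat.
Implicit Types x y z : K.
Local Notation O := (ring_of_integers K).
Local Notation Tr := (@field_trace K).

Lemma integers_int (m : int) : O m%:~R.
Proof. exact: (integral_id (intr : {rmorphism int -> K})). Qed.

Lemma integersB x y : O x -> O y -> O (x - y).
Proof. exact: (@integral_sub _ _ (intr : {rmorphism int -> K})). Qed.

Lemma integersM x y : O x -> O y -> O (x * y).
Proof. exact: (@integral_mul _ _ (intr : {rmorphism int -> K})). Qed.

Lemma integers0 : O 0. Proof. exact: integers_int 0. Qed.
Lemma integers1 : O 1. Proof. exact: integers_int 1. Qed.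

Lemma integersD x y : O x -> O y -> O (x + y).
Proof. exact: (@integral_add _ _ (intr : {rmorphism int -> K})). Qed.

Lemma integers_sum (I : finType) (P : pred I) (F : I -> K) :
  (forall i, O (F i)) -> O (\sum_(i | P i) F i).
Proof. by move=> OF; elim/big_ind: _ => //; [exact: integers0|exact: integersD]. Qed.

Lemma field_traceD x y : Tr (x + y) = Tr x + Tr y.
Proof.
have [f [_ trf _]] := embedding_spectrum K.
apply: (fmorph_inj (ratr : {rmorphism rat -> algC})).
by rewrite /= rmorphD /= !trf -big_split; apply: eq_bigr => i _; rewrite rmorphD.
Qed.

Lemma field_traceZ (a : rat) x : Tr (a *: x) = a * Tr x.
Proof.
have [f [_ trf _]] := embedding_spectrum K.
apply: (fmorph_inj (ratr : {rmorphism rat -> algC})).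
rewrite /= rmorphM /= !trf mulr_sumr; apply: eq_bigr => i _.
by rewrite rmorphZ_num.
Qed.

Lemma field_trace_sum (I : finType) (F : I -> K) : Tr (\sum_i F i) = \sum_i Tr (F i).
Proof.
elim/big_ind2: _ => [|? ? ? ? <- <-|//]; last exact: field_traceD.
by rewrite -(scale0r 0) field_traceZ mul0r.
Qed.

Lemma embedding_Aint (f : {rmorphism K -> algC}) x : O x -> f x \in Aint.
Proof.
case=> p p_mon px.
apply: (@root_monic_Aint (map_poly (intr : int -> algC) p)).
- have := rmorph_root f px; rewrite -map_poly_comp.
  congr (root _ _); apply: eq_map_poly => m /=; exact: rmorph_int.
- by rewrite monic_map.
- by apply/polyOverP => i; rewrite coef_map /= intr_int.
Qed.

Lemma ratr_is_int (q : rat) : ((ratr q : algC) \is a Num.int) = (q \is a Num.int).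
Proof.
apply/idP/idP => [/intrP[m]|/intrP[m ->]]; last by rewrite ratr_int intr_int.
by rewrite -[m%:~R](ratr_int algC) => /fmorph_inj ->; apply: intr_int.
Qed.

(** The trace is rational, and an algebraic integer as a sum of conjugates. *)
Lemma field_trace_int x : O x -> Tr x \is a Num.int.
Proof.
have [f [_ trf _]] := embedding_spectrum K.
move=> Ox; rewrite -ratr_is_int Cint_rat_Aint ?Crat_rat // trf.
by apply: rpred_sum => i _; apply: embedding_Aint.
Qed.

Section TotallyReal.
Hypothesis realK : totally_real K.

Lemma totally_positive_sqr x : x != 0 -> totally_positive (x ^+ 2).
Proof. by move=> xn f rf; rewrite rmorphXn real_exprn_even_gt0 //= fmorph_eq0. Qed.

Lemma totally_positive_neq0 x : totally_positive x -> x != 0.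
Proof.
move=> xp; apply/eqP => x0; have [f _] := embedding_spectrum K.
pose i0 : 'I_(\dim {:K}) := Ordinal (adim_gt0 {:K}%AS).
by have := xp (f i0) (realK (f i0)); rewrite x0 rmorph0 ltxx.
Qed.

Lemma totally_positiveM x y :
  totally_positive x -> totally_positive y -> totally_positive (x * y).
Proof. by move=> xp yp f rf; rewrite rmorphM mulr_gt0 ?xp ?yp. Qed.

Lemma field_trace_gt0 x : totally_positive x -> 0 < Tr x.
Proof.
have [f [_ trf _]] := embedding_spectrum K.
move=> xp; rewrite -(ltr0q algC) trf.
pose i0 : 'I_(\dim {:K}) := Ordinal (adim_gt0 {:K}%AS).
have fx_gt0 i : 0 < f i x by apply: xp; apply: realK.
by rewrite (bigD1 i0) //= ltr_wpDr ?fx_gt0 ?sumr_ge0 // => i _; apply: ltW.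
Qed.

Lemma trace_form_gt0 h x : totally_positive h -> x != 0 -> 0 < Tr (h * x * x).
Proof.
move=> hp xn; apply: field_trace_gt0; rewrite -mulrA -expr2.
by apply: totally_positiveM => //; apply: totally_positive_sqr.
Qed.

Lemma trace_form_ge0 h x : totally_positive h -> 0 <= Tr (h * x * x).
Proof.
move=> hp; have [->|/(trace_form_gt0 hp)/ltW//] := eqVneq x 0.
by rewrite mulr0 -(scale0r 0) field_traceZ mul0r.
Qed.

Section Codifferent.
Variable g : K.
Hypotheses (gp : totally_positive g) (codiff_g : codifferent_generated_by g).

Lemma trace_gen_int x : O x -> Tr (g * x) \is a Num.int.
Proof.
have : codifferent K g.
  by rewrite codiff_g; exists 1; rewrite ?mulr1 //; apply: integers1.
by apply.
Qed.

Lemma codifferentP y : (forall x, O x -> Tr (y * x) \is a Num.int) ->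
  exists2 a, O a & y = g * a.
Proof.
move=> yP; have : codifferent K y by [].
by rewrite codiff_g => -[a Oa <-]; exists a.
Qed.

(* The lattice is [O] with the form [Tr (h x y)], whose dual is [h^-1 g O]. *)
Lemma short_integers (h : K) (eps : rat) :
    totally_positive h ->
    (forall x y, O x -> O y -> Tr (h * x * y) \is a Num.int) ->
    0 < eps ->
    (forall a y, O a -> a != 0 -> h * y = g * a -> eps <= Tr (h * y * y)) ->
  exists b : seq K, [/\ size b = \dim {:K}, free b &
    forall x, x \in b -> O x /\ Tr (h * x * x) <= (4 / 3) ^+ (\dim {:K}) / eps].
Proof.
move=> hp h_int eps0 dual.
apply: (@transference _ (fun x y => Tr (h * x * y)) _ _ _ _ _ O fullv 1) => //.
- by move=> x y; rewrite mulrAC.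
- by move=> x y z; rewrite mulrDr mulrDl field_traceD.
- by move=> a x z; rewrite -scalerAr -scalerAl field_traceZ.
- by move=> x xn; apply: trace_form_gt0.
- exact: integers0.
- exact: integersB.
- by move=> x _; apply: memvf.
- by move=> x y Ox Oy; rewrite mul1r h_int.
move=> y _ yn /codifferentP[a Oa hy]; apply: (dual a) => //.
apply: contra_neq yn => a0; apply: (mulfI (totally_positive_neq0 hp)).
by rewrite hy a0 !mulr0.
Qed.

End Codifferent.
End TotallyReal.
End NumberField.

(** * Determinant bounds and the Gram matrix of the trace form *)

(** Leibniz expansion. The bound may vary with the column, so that a single small column makes the
    determinant small. *)
Lemma norm_det_le (R : numDomainType) n (A : 'M[R]_n) (c : 'I_n -> R) :
  (forall i j, `|A i j| <= c j) -> `|\det A| <= n`!%:R * \prod_j c j.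
Proof.
move=> Ac; rewrite -det_tr; apply: le_trans (ler_norm_sum _ _ _) _.
have -> : n`!%:R * \prod_j c j = \sum_(s : 'S_n) \prod_j c j.
  by rewrite sumr_const card_Sn mulr_natl.
apply: ler_sum => s _; rewrite normrM normrX normrN1 expr1n mul1r normr_prod.
by apply: ler_prod => j _; rewrite normr_ge0 mxE Ac.
Qed.

Lemma pigeonhole_modn (J : finType) (B q : nat) (t : 'I_B -> J -> int) :
    (0 < q)%N -> (q ^ #|J| < B)%N ->
  exists n m : 'I_B, n != m /\ forall j, exists k : int, t n j - t m j = k * q%:Z.
Proof.
case: q => // q _ qB.
pose F (n : 'I_B) : {ffun J -> 'I_q.+1} := [ffun j => inord `|(t n j %% q.+1%:Z)%Z|%N].
have /fintype.injectivePn[n [m nm Fnm]] : ~~ injectiveb F.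
  apply/negP => /fintype.injectiveP F_inj; have := leq_card F F_inj.
  by rewrite card_ffun !card_ord leqNgt qB.
exists n, m; split=> //.
move=> j; have := congr1 (fun f : {ffun J -> 'I_q.+1} => f j) Fnm.
rewrite !ffunE => /(congr1 (fun i : 'I_q.+1 => (i : nat)%:Z)).
have mod_lt z : (`|(z %% q.+1%:Z)%Z|%N < q.+1)%N.
  by rewrite -ltz_nat gez0_abs ?modz_ge0 // ltz_pmod.
rewrite !inordK // !gez0_abs ?modz_ge0 // => /eqP.
by rewrite eqz_mod_dvd => /dvdzP[k]; exists k.
Qed.

Lemma floor_int (q : rat) : q \is a Num.int -> (Num.floor q)%:~R = q.
Proof. by rewrite intrEfloor => /eqP. Qed.

Section Gram.
Variable K : fieldExtType rat.
Implicit Types x y z : K.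
Local Notation O := (ring_of_integers K).
Local Notation Tr := (@field_trace K).
Local Notation n := (\dim {:K}).
Hypothesis realK : totally_real K.
Variable g : K.
Hypotheses (gp : totally_positive g) (codiff_g : codifferent_generated_by g).
Variable b : n.-tuple K.
Hypotheses (fb : free b) (Ob : forall i : 'I_n, O b`_i).

(** The family [b] may span a proper sublattice of [O], so the determinant need not be 1 although
    the form is unimodular on [O]. *)
Definition gram : 'M[rat]_n := \matrix_(i, j) Tr (g * b`_i * b`_j).

Lemma free_coord x : x = \sum_(i < n) coord b i x *: b`_i.
Proof.
apply: coord_span; suff -> : (<<b>> = fullv)%VS by apply: memvf.
by apply/eqP; rewrite eqEdim subvf (eqP fb) size_tuple /=.
Qed.

Lemma trace_coord x y : Tr (g * x * y) = \sum_(i < n) coord b i x * Tr (g * b`_i * y).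
Proof.
rewrite {1}(free_coord x) mulr_sumr mulr_suml field_trace_sum; apply: eq_bigr => i _.
by rewrite -scalerAr -scalerAl field_traceZ.
Qed.

(** A kernel vector would give a nonzero [x] with [Tr (g * x * x) = 0], against positive
    definiteness. *)
Lemma gram_det_neq0 : \det gram != 0.
Proof.
apply/negP => /det0P[v vn vG].
pose x := \sum_(i < n) v 0 i *: b`_i.
have cx i : coord b i x = v 0 i by rewrite /x coord_sum_free.
have xb (j : 'I_n) : Tr (g * x * b`_j) = 0.
  rewrite trace_coord; have /esym := congr1 (fun w : 'rV_n => w 0 j) vG.
  by rewrite !mxE => e; rewrite [RHS]e; apply: eq_bigr => i _; rewrite cx mxE.
have xx : Tr (g * x * x) = 0.
  rewrite trace_coord big1 // => i _.
  by rewrite mulrAC xb mulr0.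
have x0 : x = 0.
  apply: contrapT => /eqP/(trace_form_gt0 realK gp); by rewrite xx ltxx.
by move/eqP: vn; apply; apply/rowP => i; rewrite mxE -cx x0 linear0.
Qed.

Lemma gram_intmx : exists G : 'M[int]_n, gram = map_mx intr G.
Proof.
exists (\matrix_(i, j) Num.floor (gram i j)); apply/matrixP => i j.
rewrite !mxE floor_int // -mulrA (trace_gen_int codiff_g) //.
exact: integersM.
Qed.

(* An element of [O] is divisible by [k] as soon as its coordinates
   [Tr (g x b_j)] are divisible by [k * det gram], by Cramer's rule. *)
Lemma divisible_by_trace_coords (k : nat) x :
    (forall j : 'I_n, exists m : int, Tr (g * x * b`_j) = m%:~R * (k%:R * \det gram)) ->
  exists2 z, O z & x = k%:R *: z.
Proof.
move=> /choice[m mE]; have [G GE] := gram_intmx.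
pose s : 'rV[rat]_n := \row_i coord b i x.
pose c : 'rV[int]_n := (\row_j m j) *m \adj G.
have sE : s = k%:R *: map_mx intr c.
  have sG : s *m gram = (k%:R * \det gram) *: map_mx intr (\row_j m j).
    apply/rowP => j; rewrite !mxE mulrC -mE trace_coord.
    by apply: eq_bigr => i _; rewrite !mxE.
  have := congr1 (mulmxr (\adj gram)) sG.
  rewrite /= -mulmxA mul_mx_adj mul_mx_scalar -scalemxAl mulrC -scalerA.
  move/(scalerI gram_det_neq0) => ->; congr (_ *: _).
  by rewrite map_mxM map_mx_adj GE.
exists (\sum_(i < n) (c 0 i)%:~R * b`_i).
  by apply: integers_sum => i; apply: integersM => //; apply: integers_int.
rewrite {1}(free_coord x) scaler_sumr; apply: eq_bigr => i _.
have := congr1 (fun w : 'rV[rat]_n => w 0 i) sE; rewrite !mxE => ->.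
by rewrite -scalerA; congr (_ *: _); rewrite scaler_int mulrzl.
Qed.

Variable C : rat.
Hypotheses (C1 : 1 <= C) (bC : forall i : 'I_n, Tr (g * b`_i * b`_i) <= C).

(** Positivity at [x + y] and [x - y] does the work of Cauchy-Schwarz: twice [Tr (g * x * y)] is at
    most [Tr (g * x * x) + Tr (g * y * y)] in absolute value. *)
Lemma gram_le i j : `|gram i j| <= C.
Proof.
rewrite mxE; set x := b`_i; set y := b`_j.
have Txx : Tr (g * x * x) <= C by apply: bC.
have Tyy : Tr (g * y * y) <= C by apply: bC.
have T1 : 0 <= Tr (g * x * x) + Tr (g * x * y) *+ 2 + Tr (g * y * y).
  have := trace_form_ge0 realK (x + y) gp.
  have -> : g * (x + y) * (x + y) =
    g * x * x + (g * x * y + g * x * y) + g * y * y by ring.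
  by rewrite !field_traceD.
have T2 : 0 <= Tr (g * x * x) - Tr (g * x * y) *+ 2 + Tr (g * y * y).
  have := trace_form_ge0 realK (x - y) gp.
  have -> : g * (x - y) * (x - y) =
    g * x * x + ((-1) *: (g * x * y) + (-1) *: (g * x * y)) + g * y * y.
    by rewrite scaleN1r; ring.
  by rewrite !field_traceD field_traceZ mulN1r -opprD.
rewrite ler_norml; lra.
Qed.

Lemma gram_det_le : `|\det gram| <= n`!%:R * C ^+ n.
Proof.
have := norm_det_le gram_le.
by rewrite prodr_const card_ord.
Qed.

(* With [U i j = sqrt (f_j g) f_j(b_i)] one has [U U^T = gram], so that
   [|\det U| >= 1], while the entries of [U] are at most [C]; expanding the
   determinant shows that no column of [U] is small. *)
Lemma sum_sqr_basis_ge (f : {rmorphism K -> algC}) :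
  ratr ((n`!%:R * C ^+ n.-1) ^- 2) <= f (g * \sum_(i < n) b`_i ^+ 2).
Proof.
have [e [e_all tre _]] := embedding_spectrum K.
have [j0 fj0] := e_all f; rewrite fj0.
pose U : 'M[algC]_n := \matrix_(i, j) (sqrtC (e j g) * e j b`_i).
have eg0 j : 0 < e j g by apply: gp; apply: realK.
have UU : U *m U^T = map_mx ratr gram.
  apply/matrixP => i k; rewrite !mxE tre; apply: eq_bigr => j _.
  by rewrite !mxE mulrACA -expr2 sqrtCK !rmorphM /= mulrA.
have Ureal i j : U i j \is Num.real.
  by rewrite mxE rpredM ?realK // ger0_real // sqrtC_ge0 ltW.
have U2 i j : U i j ^+ 2 = e j (g * b`_i ^+ 2).
  by rewrite mxE exprMn sqrtCK rmorphM rmorphXn.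
have U2_ge0 i j : 0 <= U i j ^+ 2 by rewrite real_exprn_even_ge0.
set s := e j0 _.
have sE : s = \sum_i U i j0 ^+ 2.
  by rewrite /s mulr_sumr rmorph_sum; apply: eq_bigr => i _; rewrite U2.
have s_ge0 : 0 <= s by rewrite sE sumr_ge0.
have norm_le i j (x : algC) : 0 <= x -> U i j ^+ 2 <= x ^+ 2 -> `|U i j| <= x.
  by move=> x0; rewrite -real_normK // ler_sqr ?nnegrE.
have UC i j : `|U i j| <= ratr C.
  have C1' : 1 <= ratr C :> algC.
    by rewrite -(rmorph1 (ratr : {rmorphism rat -> algC})) ler_rat.
  apply: norm_le; first exact: le_trans C1'.
  apply: (@le_trans _ _ (ratr C)); last by rewrite expr2 ler_peMr // (le_trans _ C1').
  apply: (@le_trans _ _ (ratr (Tr (g * b`_i * b`_i)))); last by rewrite ler_rat.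
  rewrite tre (bigD1 j) //= U2 expr2 mulrA lerDl sumr_ge0 // => k _.
  by rewrite -mulrA -expr2 -U2.
have Us i : `|U i j0| <= sqrtC s.
  apply: norm_le; first by rewrite sqrtC_ge0.
  by rewrite sqrtCK sE (bigD1 i) //= lerDl sumr_ge0.
(* Column [j0] is bounded by [sqrtC s], the others by [C]. The expansion then gives
   [1 <= n! * C ^ (n - 1) * sqrtC s], hence the exponent -2 in the claim. *)
pose c j := if j == j0 then sqrtC s else ratr C : algC.
have Uc i j : `|U i j| <= c j by rewrite /c; case: eqP => [->|_].
have detU : 1 <= `|\det U|.
  rewrite -(@ler_sqr _ 1) ?nnegrE // expr1n -normrX expr2 -{2}det_tr -det_mulmx UU.
  rewrite det_map_mx; have [G GE] := gram_intmx.
  have := gram_det_neq0; rewrite GE det_map_mx /= ratr_int intr_eq0 => dG.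
  by rewrite norm_intr_ge1 ?intr_eq0 // intr_int.
have := le_trans detU (norm_det_le Uc).
rewrite (bigD1 j0) //= {1}/c eqxx (eq_bigr (fun=> ratr C)); last first.
  by move=> j /negPf; rewrite /c => ->.
rewrite prodr_const cardC1 card_ord mulrCA.
pose E : algC := n`!%:R * ratr C ^+ n.-1; rewrite -/E.
have -> : ratr ((n`!%:R * C ^+ n.-1) ^- 2) = E ^- 2.
  by rewrite fmorphV rmorphXn rmorphM rmorph_nat rmorphXn.
have E0 : 0 < E.
  rewrite mulr_gt0 ?ltr0n ?fact_gt0 // exprn_gt0 // ltr0q.
  exact: lt_le_trans C1.
move=> h; rewrite -[leLHS]mul1r ler_pdivrMr ?exprn_gt0 //.
rewrite -[s]sqrtCK -exprMn -(expr1n _ 2) lerXn2r ?nnegrE //.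
by rewrite mulr_ge0 ?sqrtC_ge0 // ltW.
Qed.

End Gram.

(** * Values of a universal form *)

Section UniversalForm.
Variable K : fieldExtType rat.
Implicit Types x y z : K.
Local Notation O := (ring_of_integers K).
Local Notation Tr := (@field_trace K).
Local Notation n := (\dim {:K}).
Hypothesis realK : totally_real K.
Variable g : K.
Hypotheses (gp : totally_positive g) (codiff_g : codifferent_generated_by g).

Lemma int_ge1 (q : rat) : q \is a Num.int -> 0 < q -> 1 <= q.
Proof. by move=> /intrP[m ->]; rewrite ltr0z ler1z. Qed.

(** Take [h = g]: the lattice [O] is then its own dual, and its nonzero vectors have positive
    integral squared length, so [eps = 1] is allowed. *)
Lemma unimodular_short_basis : exists b : n.-tuple K,
  free b /\ forall i : 'I_n, O b`_i /\ Tr (g * b`_i * b`_i) <= (4 / 3) ^+ n.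
Proof.
have g0 : g != 0 by apply: totally_positive_neq0 gp.
have [| |b [/eqP sb fb bP]] := @short_integers K realK g codiff_g g 1 gp _ ltr01.
- by move=> x y Ox Oy; rewrite -mulrA trace_gen_int //; apply: integersM.
- move=> a y Oa an /(mulfI g0) ->; apply: int_ge1; last exact: trace_form_gt0.
  by rewrite -mulrA trace_gen_int //; apply: integersM.
exists (Tuple sb); split=> // i; rewrite -[(4 / 3) ^+ _]divr1.
by apply: bP; rewrite mem_nth // (eqP sb).
Qed.

Variables (R : nat) (a : 'M[K]_R).
Hypothesis univ_a : universal_qform a.

Lemma qformZ (c : K) (x : 'rV[K]_R) : qform a (c *: x) = c ^+ 2 * qform a x.
Proof.
rewrite /qform mulr_sumr; apply: eq_bigr => i _; rewrite mulr_sumr.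
by apply: eq_bigr => j _; rewrite !mxE; ring.
Qed.

Lemma qform_parallelogram (x y : 'rV[K]_R) :
  qform a (x - y) + qform a (x + y) = qform a x *+ 2 + qform a y *+ 2.
Proof.
rewrite /qform -!sumrMnl -!big_split; apply: eq_bigr => i _.
rewrite -!sumrMnl -!big_split; apply: eq_bigr => j _ /=.
by rewrite !mxE; ring.
Qed.

Lemma integral_mxD (x y : 'rV[K]_R) :
  integral_mx x -> integral_mx y -> integral_mx (x + y).
Proof. by move=> Ox Oy i j; rewrite !mxE; apply: integersD; [apply: Ox|apply: Oy]. Qed.

Lemma qform_int (x : 'rV[K]_R) : integral_mx x -> O (qform a x).
Proof.
case: univ_a => Oa _ _ Ox; apply: integers_sum => i; apply: integers_sum => j.
by apply: integersM => //; apply: integersM.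
Qed.

Lemma trace_qform_ge0 (x : 'rV[K]_R) : integral_mx x -> 0 <= Tr (g * qform a x).
Proof.
case: univ_a => _ pos_a _ Ox.
have [->|xn] := eqVneq x 0; last first.
  apply: ltW; apply: field_trace_gt0 => //.
  by apply: totally_positiveM => //; apply: pos_a.
have := qformZ 0 0; rewrite scale0r expr0n mul0r => ->.
by rewrite mulr0 -(scale0r 0) field_traceZ mul0r.
Qed.

Lemma trace_qform_ge1 (x : 'rV[K]_R) :
  integral_mx x -> x != 0 -> 1 <= Tr (g * qform a x).
Proof.
case: univ_a => _ pos_a _ Ox xn; apply: int_ge1.
  by apply: trace_gen_int => //; apply: qform_int.
by apply: field_trace_gt0 => //; apply: totally_positiveM => //; apply: pos_a.
Qed.

(* Two vectors of [O^R] congruent modulo [k] on which the integral form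
   [Tr (g Q)] is at most [M] must coincide once [4 M < k ^ 2]; hence [Q] takes
   boundedly many values of trace at most [M]. *)
Lemma few_values (M A B : nat) (w : 'I_B -> K) :
    n`!%:R * ((4 / 3) ^+ n) ^+ n <= A%:R :> rat ->
    (((4 * M).+1 * A) ^ (R * n) < B)%N ->
    (forall i, O (w i)) -> (forall i, totally_positive (w i)) ->
    (forall i, Tr (g * w i) <= M%:R) ->
  exists i j, i != j /\ w i = w j.
Proof.
move=> hA hB Ow wp wM; set k := (4 * M).+1 in hB.
have [b [fb bP]] := unimodular_short_basis.
have Ob (i : 'I_n) : O b`_i by have [] := bP i.
have C1 : 1 <= (4 / 3) ^+ n :> rat by apply: exprn_ege1.
have dle : `|\det (gram g b)| <= n`!%:R * ((4 / 3) ^+ n) ^+ n.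
  by apply: gram_det_le => // i; have [] := bP i.
have [G GE] := gram_intmx codiff_g Ob.
have dE : \det (gram g b) = (\det G)%:~R by rewrite GE det_map_mx.
have dn := gram_det_neq0 realK gp fb.
pose D := `|\det G|%N.
have D0 : (0 < D)%N by rewrite absz_gt0 -(intr_eq0 rat) -dE.
have DA : (D <= A)%N.
  rewrite -(ler_nat rat) (le_trans _ hA) // (le_trans _ dle) //.
  by rewrite dE -intr_norm -abszE.
have /choice[x xP] : forall i, exists x : 'rV[K]_R, integral_mx x /\ qform a x = w i.
  move=> i; case: univ_a => _ _ /(_ (w i) (Ow i) (wp i))[x Ox xw].
  by exists x.
pose t i (rj : 'I_R * 'I_n) := Num.floor (Tr (g * x i 0 rj.1 * b`_rj.2)).
have tE i r (j : 'I_n) : (t i (r, j))%:~R = Tr (g * x i 0 r * b`_j).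
  rewrite floor_int // -mulrA trace_gen_int //; apply: integersM => //.
  by have [Ox _] := xP i; apply: Ox.
have [||i [j [ij tij]]] := @pigeonhole_modn _ B (k * D) t.
- by rewrite muln_gt0.
- rewrite card_prod !card_ord; apply: leq_ltn_trans hB.
  by case: (R * n)%N => // e; rewrite leq_exp2r // leq_mul2l DA orbT.
exists i, j; split=> //; apply: contrapT => wij.
have /choice[z zP] : forall r, exists z, O z /\ x i 0 r - x j 0 r = k%:R *: z.
  move=> r.
  have [|z Oz zE] :=
    divisible_by_trace_coords realK gp codiff_g fb Ob (k := k)
      (x := x i 0 r - x j 0 r).
    move=> l; have [m mE] := tij (r, l).
    (* The congruence is modulo [k * D] with [D] the absolute value of the determinant; its sign
       goes into the multiplier. *)
    exists (m * Num.sg (\det G)).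
    have -> : Tr (g * (x i 0 r - x j 0 r) * b`_l) =
        Tr (g * x i 0 r * b`_l) - Tr (g * x j 0 r * b`_l).
      rewrite mulrBr mulrBl field_traceD; congr (_ + _).
      by rewrite -scaleN1r field_traceZ mulN1r.
    rewrite -!tE -intrB mE dE -[k%:R]/(k%:~R) -!intrM; congr (_%:~R).
    by rewrite PoszM /D abszE normrEsg; ring.
  by exists z.
pose Z : 'rV[K]_R := \row_r z r.
have ZE : x i - x j = k%:R *: Z.
  apply/rowP => r; have [_ e] := zP r; rewrite !mxE e.
  by rewrite scaler_nat mulr_natl.
have OZ : integral_mx Z by move=> ? r; rewrite mxE; have [] := zP r.
have Zn : Z != 0.
  apply/eqP => Z0; move: ZE; rewrite Z0 scaler0 => /subr0_eq xij.
  by apply: wij; rewrite -(xP i).2 xij (xP j).2.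
have [Oxi xi] := xP i; have [Oxj xj] := xP j.
have h1 := trace_qform_ge1 OZ Zn.
have h2 := trace_qform_ge0 (integral_mxD Oxi Oxj).
have TrN m y : Tr (g * (m%:R * y)) = m%:R * Tr (g * y).
  by rewrite -field_traceZ scaler_nat mulr_natl mulrnAr.
(* With [x i - x j = k Z], the parallelogram law bounds [k ^ 2 * Tr (g Q(Z))] by [4 M < k ^ 2],
   while [Tr (g Q(Z)) >= 1]. *)
have := congr1 (fun y => Tr (g * y)) (qform_parallelogram (x i) (x j)).
rewrite ZE qformZ -natrX xi xj -[w i *+ 2]mulr_natl -[w j *+ 2]mulr_natl.
rewrite !mulrDr !field_traceD !TrN.
have wi := wM i; have wj := wM j.
have k2 : (4 * M%:R < (k ^ 2)%:R :> rat).
  rewrite -natrM ltr_nat /k; apply: (@leq_trans (4 * M).+1) => //.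
  by rewrite expnS expn1 leq_pmulr.
move: h1 h2 wi wj k2; clear => h1 h2 wi wj k2 e; nra.
Qed.

Lemma embedding_sqr_le (f : {rmorphism K -> algC}) x :
  `|f x| ^+ 2 <= ratr (Tr (x * x)).
Proof.
have [e [e_all tre _]] := embedding_spectrum K.
have [j fj] := e_all f; rewrite fj tre (bigD1 j) //= real_normK ?realK //.
rewrite -expr2 rmorphXn lerDl sumr_ge0 // => i _.
by rewrite rmorphXn real_exprn_even_ge0 ?realK.
Qed.

(* If [g x] were small at every embedding, the elements [c + i x], with [c] the
   sum of squares of a short basis, would be too many values of [Q]. *)
Lemma dual_trace_ge (M A B : nat) (delta : rat) :
    n`!%:R * ((4 / 3) ^+ n) ^+ n <= A%:R :> rat ->
    (((4 * M).+1 * A) ^ (R * n) < B)%N ->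
    delta = (n`!%:R * ((4 / 3) ^+ n) ^+ n.-1) ^- 2 ->
    n%:R * (4 / 3) ^+ n + n%:R * delta <= M%:R ->
  forall x, O x -> x != 0 -> (delta / B%:R) ^+ 2 <= Tr ((g * x) * (g * x)).
Proof.
move=> hA hB deltaE hM x Ox xn; rewrite leNgt; apply/negP => Tr_lt.
have B0 : (0 < B)%N by apply: leq_ltn_trans hB.
have C1 : 1 <= (4 / 3) ^+ n :> rat by apply: exprn_ege1.
have delta0 : 0 < delta.
  rewrite deltaE invr_gt0 exprn_gt0 // mulr_gt0 ?ltr0n ?fact_gt0 //.
  by rewrite exprn_gt0 // (lt_le_trans _ C1).
have small (f : {rmorphism K -> algC}) : B%:R * `|f (g * x)| < ratr delta :> algC.
  rewrite mulrC -ltr_pdivlMr ?ltr0n //.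
  have -> : ratr delta / B%:R = ratr (delta / B%:R) :> algC.
    by rewrite rmorphM /= fmorphV /= ratr_nat.
  have h := le_lt_trans (embedding_sqr_le f (g * x)) _.
  have := h (ratr ((delta / B%:R) ^+ 2)); rewrite ltr_rat => /(_ Tr_lt).
  rewrite rmorphXn /= ltr_sqr ?nnegrE // ler0q divr_ge0 // ltW //.
have [b [fb bP]] := unimodular_short_basis.
have Ob (i : 'I_n) : O b`_i by have [] := bP i.
pose c := \sum_(i < n) b`_i ^+ 2.
have Oc : O c by apply: integers_sum => i; rewrite expr2; apply: integersM.
have c_ge (f : {rmorphism K -> algC}) : ratr delta <= f (g * c).
  rewrite deltaE; apply: sum_sqr_basis_ge => // i; have [] := bP i => //.
(* As [i < B], the term [i x] changes each conjugate of [g c] by less than [delta], which is a lower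
   bound for it. So [w i] stays totally positive, and the trace grows by at most [n * delta]. *)
pose w (i : 'I_B) := c + (i : nat)%:R * x.
have [e [e_all tre _]] := embedding_spectrum K.
have fw (f : {rmorphism K -> algC}) (i : 'I_B) :
  `|f (g * w i) - f (g * c)| < ratr delta.
  have -> : f (g * w i) - f (g * c) = i%:R * f (g * x).
    by rewrite -rmorphB -mulrBr /w addrC addKr mulrCA [LHS]rmorphM rmorph_nat.
  rewrite normrM normr_nat; apply: le_lt_trans (small f).
  by rewrite ler_wpM2r // ler_nat ltnW.
have fwP (f : {rmorphism K -> algC}) (i : 'I_B) :
  0 < f (g * w i) /\ f (g * w i) <= f (g * c) + ratr delta.
  have := fw f i; rewrite real_ltr_norml ?rpredB ?realK // => /andP[h1 h2].
  split; last by rewrite addrC -lerBlDr ltW.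
  have : ratr delta < f (g * w i) + ratr delta.
    apply: le_lt_trans (c_ge f) _.
    by move: h1; rewrite ltrBrDr addrC ltrBlDr.
  by rewrite ltrDr.
have wp i : totally_positive (w i).
  move=> f rf; have [h _] := fwP f i.
  by rewrite -(pmulr_rgt0 _ (gp rf)) -rmorphM.
have Ow i : O (w i).
  by apply: integersD => //; apply: integersM => //; apply: (integers_int K i).
have Tr_c : Tr (g * c) <= n%:R * (4 / 3) ^+ n.
  rewrite mulr_sumr field_trace_sum -[X in X%:R]card_ord mulr_natl -sumr_const.
  by apply: ler_sum => i _; rewrite expr2 mulrA; have [] := bP i.
have Tr_w i : Tr (g * w i) <= M%:R.
  apply: le_trans hM; apply: (@le_trans _ _ (Tr (g * c) + n%:R * delta)); last first.
    by rewrite lerD2r.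
  rewrite -(ler_rat algC) rmorphD rmorphM /= ratr_nat !tre.
  have -> : n%:R * ratr delta = \sum_(j < n) (ratr delta : algC).
    by rewrite sumr_const card_ord mulr_natl.
  by rewrite -big_split ler_sum // => j _; have [] := fwP (e j) i.
have [i [j [ij]]] := few_values hA hB Ow wp Tr_w.
(* Since [x] is nonzero and the characteristic is 0, distinct indices give distinct [w i]. *)
move/addrI/(mulIf xn) => /eqP; rewrite -!(rmorph_nat (in_alg K)).
rewrite (inj_eq (fmorph_inj _)) eqr_nat => /eqP eij.
by move: ij; rewrite (ord_inj eij) eqxx.
Qed.

End UniversalForm.

(** * Finiteness *)

Lemma le_abs_ceil (q : rat) : q <= `|Num.ceil q|%N%:R.
Proof. by rewrite natr_absz (le_trans (ceil_ge _)) // ler_int ler_norm. Qed.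

(** Each factor ['X - z] multiplies a bound on the coefficients by at most [1 + D]. *)
Lemma coef_prod_XsubC_le (R : numDomainType) (I : Type) (r : seq I)
    (z : I -> R) (D : R) k :
    (forall i, `|z i| <= D) ->
  `|(\prod_(i <- r) ('X - (z i)%:P))`_k| <= (1 + D) ^+ size r.
Proof.
move=> zD; elim: r k => [|i r IHr] k.
  by rewrite big_nil coef1 expr0; case: eqP; rewrite ?normr1 ?normr0.
have D0 : 0 <= D := le_trans (normr_ge0 _) (zD i).
rewrite big_cons mulrBl coefB coefXM coefCM /= exprS mulrDl mul1r.
apply: le_trans (ler_normB _ _) _; rewrite normrM lerD //; last by rewrite ler_pM.
by case: eqP => _ //; rewrite normr0 exprn_ge0 // addr_ge0.
Qed.

(** The trace of [x * x] bounds the conjugates of [x], hence the coefficients of its characteristic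
    polynomial, which are integers. Only finitely many polynomials qualify, and [s] collects their
    roots independently of the field. *)
Lemma bounded_integers_finite (d : nat) (C : rat) : exists s : seq algC,
  forall (K : fieldExtType rat) (f : {rmorphism K -> algC}) (x : K),
    \dim {:K} = d -> totally_real K -> ring_of_integers K x ->
    field_trace (x * x) <= C -> f x \in s.
Proof.
(* This choice has [C <= D ^+ 2], which avoids a square root. *)
pose D : rat := 1 + `|C|.
have D1 : 1 <= D by rewrite lerDl.
pose N := `|Num.ceil ((1 + D) ^+ d)|%N.
have DN : (1 + ratr D) ^+ d <= N%:R :> algC.
  have -> : (1 + ratr D) ^+ d = ratr ((1 + D) ^+ d) :> algC.
    by rewrite [RHS]rmorphXn /= [in RHS]rmorphD /= [in RHS]rmorph1.
  rewrite -(ratr_nat algC) ler_rat; exact: le_abs_ceil.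
(* An integer coefficient between [-N] and [N] is stored shifted by [N], as an element of a finite
   type. *)
pose P (u : {ffun 'I_d.+1 -> 'I_(N + N).+1}) : {poly algC} :=
  \poly_(k < d.+1) ((u (inord k))%:R - N%:R).
exists (flatten [seq sval (closed_field_poly_normal (P u)) |
          u : {ffun 'I_d.+1 -> 'I_(N + N).+1}]).
move=> K f x dimK realK Ox xC.
have [e [e_all _ /(_ x)[p pE]]] := embedding_spectrum K.
set q := \prod_i _ in pE.
have szI : size (index_enum 'I_(\dim {:K})) = d.
  by rewrite [index_enum _]unlock -enumT size_enum_ord.
have exD i : `|e i x| <= ratr D.
  have D0 : 0 <= ratr D :> algC by rewrite ler0q (le_trans ler01).
  rewrite -ler_sqr ?nnegrE // (le_trans (embedding_sqr_le realK _ _)) //.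
  rewrite -rmorphXn ler_rat (le_trans xC) // (le_trans (ler_norm C)) //.
  by rewrite /D; have := normr_ge0 C; nra.
have qN k : `|q`_k| <= N%:R.
  apply: le_trans DN; rewrite /q; have := coef_prod_XsubC_le (index_enum _) k exD.
  by rewrite szI.
have q_int k : q`_k \is a Num.int.
  apply: Cint_rat_Aint; first by rewrite -pE coef_map Crat_rat.
  suff /polyOverP : q \is a polyOver Aint by apply.
  apply: rpred_prod => i _; rewrite polyOverXsubC; exact: embedding_Aint.
have sq : size q = d.+1.
  by rewrite /q size_prod_XsubC szI.
have /choice[u uE] : forall k : 'I_d.+1, exists j : 'I_(N + N).+1, q`_k = j%:R - N%:R.
  move=> k; have /intrP[m mE] := q_int k.
  have := qN k; rewrite mE -intr_norm -[N%:R]/(N%:~R) ler_int => mN.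
  have mlt : (`|(m + N%:Z)%R|%N < (N + N).+1)%N by lia.
  exists (Ordinal mlt); rewrite /= -[X in X - _]/(`|(m + N%:Z)%R|%N%:~R) -intrB.
  congr (_%:~R); lia.
have qP : q = P (finfun u).
  apply/polyP => k; rewrite coef_poly; case: ltnP => kd.
    by rewrite ffunE -uE inordK.
  by rewrite nth_default // sq.
have fx_root : root q (f x).
  have [i ->] := e_all f; rewrite /q /root horner_prod (bigD1 i) //=.
  by rewrite !hornerE subrr mul0r.
apply/flattenP; exists (sval (closed_field_poly_normal (P (finfun u)))).
  by apply/mapP; exists (finfun u); rewrite ?mem_enum.
case: (closed_field_poly_normal _) => r /= rE.
rewrite -root_prod_XsubC; move: fx_root; rewrite qP rE rootZ //.
by rewrite -qP lead_coef_eq0 -size_poly_eq0 sq.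
Qed.

(** All constants are fixed from [d] and [R] before the field is given, which makes the bound
    uniform. *)
Lemma dual_trace_bound (d R : nat) : exists2 eps : rat, 0 < eps &
  forall (K : fieldExtType rat) (g x : K), \dim {:K} = d -> totally_real K ->
    totally_positive g -> codifferent_generated_by g ->
    (exists a : 'M[K]_R, universal_qform a) ->
    ring_of_integers K x -> x != 0 -> eps <= field_trace ((g * x) * (g * x)).
Proof.
pose c : rat := (4 / 3) ^+ d.
pose A := `|Num.ceil (d`!%:R * c ^+ d)|%N.
pose delta : rat := (d`!%:R * c ^+ d.-1) ^- 2.
pose M := `|Num.ceil (d%:R * c + d%:R * delta)|%N.
(* One more than the bound on the number of residue classes, for the pigeonhole. *)
pose B := (((4 * M).+1 * A) ^ (R * d)).+1.
have c0 : 0 < c by rewrite exprn_gt0.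
exists ((delta / B%:R) ^+ 2).
  rewrite exprn_gt0 // divr_gt0 ?ltr0n // invr_gt0 exprn_gt0 //.
  by rewrite mulr_gt0 ?exprn_gt0 // ltr0n fact_gt0.
move=> K g x dimK realK gp cg [a univ_a].
apply: (dual_trace_ge realK gp cg univ_a (M := M) (A := A)); rewrite dimK //.
  exact: le_abs_ceil.
exact: le_abs_ceil.
Qed.

Theorem theorem1p2 (d R : nat) (hd : (0 < d)%N) (hR : (0 < R)%N) :
  finite_set [set L : set algC |
    exists (K : fieldExtType rat) (iota : {rmorphism K -> algC}),
      [/\ L = range iota,
          \dim {:K} = d,
          totally_real K,
          exists g : K, totally_positive g /\ codifferent_generated_by g
        & exists a : 'M[K]_R, universal_qform a]].
Proof.
have [eps eps0 epsP] := dual_trace_bound d R.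
have [s sP] := bounded_integers_finite d ((4 / 3) ^+ d / eps).
(* The image of a field in [algC] is recovered as the rational span of [d] elements of [s], and
   there are finitely many choices of these. *)
pose S (u : {ffun 'I_d -> seq_sub s}) : set algC :=
  [set y | exists q : 'I_d -> rat, y = \sum_i ratr (q i) * val (u i)].
apply: (@sub_finite_set _ _ (S @` setT)); last exact/finite_image/finite_finset.
move=> L [K [iota [-> dimK realK [g [gp cg]] univ_a]]].
have tp1 : totally_positive (1 : K) by move=> f _; rewrite rmorph1.
(* With [h = 1] the dual vectors are the multiples [g * a], whose squared length [epsP] bounds below
   by [eps]. *)
have [| |b [sb fb bP]] := @short_integers K realK g cg 1 eps tp1 _ eps0.
- by move=> x y Ox Oy; rewrite mul1r; apply: field_trace_int; apply: integersM.
- move=> a y Oa an; rewrite !mul1r => ->.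
  exact: epsP.
have bs (i : 'I_d) : iota b`_i \in s.
  have [|Ob Tb] := bP b`_i; first by rewrite mem_nth // sb dimK.
  by apply: sP => //; move: Tb; rewrite mul1r dimK.
exists [ffun i => SeqSub (bs i)] => //.
apply/seteqP; split=> [_ [q ->]|_ [x _ <-]].
  exists (\sum_(i < d) q i *: b`_i) => //; rewrite rmorph_sum.
  by apply: eq_bigr => i _; rewrite rmorphZ_num ffunE.
have xb : x \in <<b>>%VS.
  suff -> : (<<b>> = fullv)%VS by apply: memvf.
  by apply/eqP; rewrite eqEdim subvf (eqP fb) sb /=.
have sbd : size b = d by rewrite sb.
pose bt : d.-tuple K := Tuple (introT eqP sbd).
exists (fun i => coord bt i x); rewrite {1}(@coord_span _ _ _ bt x) // rmorph_sum.
by apply: eq_bigr => i _; rewrite rmorphZ_num ffunE.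
Qed.
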